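(* Let $E$ be an order complete vector lattice. For each band $B$ of $E$, the set $$\{T\in\mathcal L_r(E):\ \mathcal P_E(T)=\mathcal P_B(T)\}$$ is a band in $\mathcal L_r(E)$.
   Context: $\mathcal L_r(E)$ is the order complete vector lattice of regular operators on $E$ (differences of positive operators). $\mathrm{Orth}(E)$ is the set of orthomorphisms of $E$ (order bounded operators leaving every band of $E$ invariant); for $E$ order complete it is a projection band in $\mathcal L_r(E)$, namely the band generated by the identity operator. $\mathcal P_E$ denotes the band projection of $\mathcal L_r(E)$ onto $\mathrm{Orth}(E)$; $\mathcal P_E(T)$ is called the diagonal of $T$. For a band $B$ of $E$ with band projection $P_B$ and $T\in\mathcal L_r(E)$, $\mathcal P_B(T)$ denotes the diagonal, in the order complete vector lattice $B$, of the compression $P_BTP_B$ (regarded as an operator on $B$); via $\mathrm{Orth}(E)\cong\mathrm{Orth}(B)\oplus\mathrm{Orth}(B^d)$ it is regarded as an operator on $E$ that is zero on $B^d$. *)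

(* Defs.v *)
From HB Require Import structures.
From mathcomp Require Import all_boot all_order all_algebra.
From mathcomp Require Import boolp classical_sets functions reals.

Set Implicit Arguments.
Unset Strict Implicit.
Unset Printing Implicit Defensive.

Import Order.TTheory GRing.Theory Num.Theory.

Local Open Scope classical_set_scope.
Local Open Scope ring_scope.

(* The lattice operations do not come from Order.Lattice: Hierarchy Builder
   accepts no join of Lmodule and Order.Lattice, since RealDomain already
   inherits from Algebra.BaseAddMagma and Order.MeetSemilattice. *)
HB.mixin Record isVectorLattice (R : realType) E
    of GRing.Lmodule R E & Order.POrder ring_display E := {
  lev_add2r : forall z x y : E, x <= y -> x + z <= y + z;
  scalev_ge0 : forall (a : R) (x : E), 0 <= a -> 0 <= x -> 0 <= a *: x;
  vjoin : E -> E -> E;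
  vmeet : E -> E -> E;
  vjoinP : forall x y z : E, (vjoin x y <= z) = (x <= z) && (y <= z);
  vmeetP : forall x y z : E, (x <= vmeet y z) = (x <= y) && (x <= z)
}.

#[short(type="vectorLatticeType")]
HB.structure Definition VectorLattice (R : realType) :=
  { E of GRing.Lmodule R E & Order.POrder ring_display E
       & isVectorLattice R E }.

Arguments scalev_ge0 {R s} [a x].
Arguments lev_add2r {R s} z [x y].

HB.mixin Record isOrderComplete (R : realType) E of VectorLattice R E := {
  order_complete : forall A : set E, has_sup A -> supremums A !=set0
}.

#[short(type="ocVectorLatticeType")]
HB.structure Definition OCVectorLattice (R : realType) :=
  { E of VectorLattice R E & isOrderComplete R E }.

Section VectorLatticeDefs.
Context {R : realType} {E : vectorLatticeType R}.
Implicit Types (x y z : E) (A B : set E).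

Definition modulus x : E := vjoin x (- x).

Definition disjoint_elts x y : Prop := vmeet (modulus x) (modulus y) = 0.

Definition disjoint_compl A : set E :=
  [set x | forall y, A y -> disjoint_elts x y].

Definition is_ideal A : Prop :=
  [/\ A 0,
      (forall (a : R) x y, A x -> A y -> A (a *: x + y)) &
      (forall x y, modulus x <= modulus y -> A y -> A x)].

Definition is_band B : Prop :=
  is_ideal B /\ (forall A s, A `<=` B -> supremums A s -> B s).

(* The component in B of x along the decomposition B (+) B^d; the default 0
   is returned if x has no such component, which does not happen when B is a
   projection band (see [band_projP]). *)
Definition band_proj B x : E :=
  xget 0 [set y | B y /\ disjoint_compl B (x - y)].

Definition positive_op (T : E -> E) : Prop :=
  linear T /\ forall x, 0 <= x -> 0 <= T x.

Definition regular_op (T : E -> E) : Prop :=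
  exists U V, [/\ positive_op U, positive_op V & T = U - V].

Definition order_bounded_op (T : E -> E) : Prop :=
  forall a b, exists c d, forall x, a <= x <= b -> c <= T x <= d.

Definition orthomorphism (T : E -> E) : Prop :=
  [/\ linear T, order_bounded_op T &
      forall B, is_band B -> forall x, B x -> B (T x)].

End VectorLatticeDefs.

Section VectorLatticeTheory.
Context {R : realType} {E : vectorLatticeType R}.
Implicit Types (x y z : E) (A B : set E).

Lemma lev_joinl x y : x <= vjoin x y.
Proof. by have := lexx (vjoin x y); rewrite vjoinP => /andP[]. Qed.

Lemma lev_joinr x y : y <= vjoin x y.
Proof. by have := lexx (vjoin x y); rewrite vjoinP => /andP[]. Qed.

Lemma vmeet_lel x y : vmeet x y <= x.
Proof. by have := lexx (vmeet x y); rewrite vmeetP => /andP[]. Qed.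

Lemma vmeet_ler x y : vmeet x y <= y.
Proof. by have := lexx (vmeet x y); rewrite vmeetP => /andP[]. Qed.

Lemma vjoinC x y : vjoin x y = vjoin y x.
Proof.
by apply/le_anti; rewrite !vjoinP !lev_joinl !lev_joinr.
Qed.

Lemma vmeetC x y : vmeet x y = vmeet y x.
Proof.
by apply/le_anti; rewrite !vmeetP !vmeet_lel !vmeet_ler.
Qed.

Lemma lev_add2rE z x y : (x + z <= y + z) = (x <= y).
Proof.
apply/idP/idP => [h|]; last exact: lev_add2r.
by rewrite -[x](addrK z) -[y](addrK z); exact: lev_add2r.
Qed.

Lemma lev_add2lE z x y : (z + x <= z + y) = (x <= y).
Proof. by rewrite ![z + _]addrC lev_add2rE. Qed.

Lemma subv_ge0 x y : (0 <= y - x) = (x <= y).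
Proof. by rewrite -(lev_add2rE x 0) add0r subrK. Qed.

Lemma lev_subrE x y z : (x <= y - z) = (x + z <= y).
Proof. by rewrite -(lev_add2rE z x) subrK. Qed.

Lemma lev_sublE x y z : (x - y <= z) = (x <= z + y).
Proof. by rewrite -(lev_add2rE y (x - y)) subrK. Qed.

Lemma lev_oppE x y : (- x <= - y) = (y <= x).
Proof. by rewrite -(subv_ge0 (- x)) opprK addrC subv_ge0. Qed.

Lemma lev_add x y z t : x <= y -> z <= t -> x + z <= y + t.
Proof.
by move=> xy zt; apply: (@le_trans _ _ (y + z));
  rewrite (lev_add2rE, lev_add2lE).
Qed.

Lemma addv_ge0 x y : 0 <= x -> 0 <= y -> 0 <= x + y.
Proof. by move=> x0 y0; rewrite -[0]addr0; exact: lev_add. Qed.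

Lemma oppv_le0 x : (- x <= 0) = (0 <= x).
Proof. by rewrite -[X in _ <= X]oppr0 lev_oppE. Qed.

Lemma oppv_ge0 x : (0 <= - x) = (x <= 0).
Proof. by rewrite -[X in X <= _]oppr0 lev_oppE. Qed.

Lemma lev_scale (a : R) x y : 0 <= a -> x <= y -> a *: x <= a *: y.
Proof.
move=> a0 xy; rewrite -subv_ge0 -scalerBr; apply: scalev_ge0 => //.
by rewrite subv_ge0.
Qed.

Lemma le_modulus x : x <= modulus x.
Proof. exact: lev_joinl. Qed.

Lemma leN_modulus x : - x <= modulus x.
Proof. exact: lev_joinr. Qed.

Lemma modulusN x : modulus (- x) = modulus x.
Proof. by rewrite /modulus opprK vjoinC. Qed.

Lemma modulus_ge0 x : 0 <= modulus x.
Proof.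
have : 0 <= modulus x + modulus x.
  by rewrite -(subrr x); apply: lev_add; [exact: le_modulus|exact: leN_modulus].
move=> /(scalev_ge0 (_ : 0 <= 2^-1 :> R)).
rewrite -mulr2n -scaler_nat scalerA mulVf ?scale1r ?pnatr_eq0//.
by apply; rewrite invr_ge0.
Qed.

Lemma ger0_modulus x : 0 <= x -> modulus x = x.
Proof.
move=> x0; apply/le_anti; rewrite lev_joinl vjoinP lexx andbT /=.
by apply: (le_trans _ x0); rewrite oppv_le0.
Qed.

Lemma modulus0 : modulus (0 : E) = 0.
Proof. exact: ger0_modulus. Qed.

Lemma modulus_le x y : x <= y -> - x <= y -> modulus x <= y.
Proof. by move=> h1 h2; rewrite /modulus vjoinP h1. Qed.

Lemma modulusD x y : modulus (x + y) <= modulus x + modulus y.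
Proof.
apply: modulus_le; first by apply: lev_add; exact: le_modulus.
by rewrite opprD; apply: lev_add; exact: leN_modulus.
Qed.

Definition pospart x : E := vjoin x 0.
Definition negpart x : E := vjoin (- x) 0.

Lemma pospart_ge0 x : 0 <= pospart x. Proof. exact: lev_joinr. Qed.
Lemma negpart_ge0 x : 0 <= negpart x. Proof. exact: lev_joinr. Qed.

Lemma pospartBnegpart x : pospart x - negpart x = x.
Proof.
apply/eqP; rewrite subr_eq; apply/eqP/le_anti/andP; split.
- rewrite /pospart vjoinP; apply/andP; split.
    by rewrite -{1}(addr0 x) lev_add2lE negpart_ge0.
  by rewrite -(subrr x) lev_add2lE lev_joinl.
- rewrite addrC -lev_subrE /negpart vjoinP; apply/andP; split.
    by rewrite -[in leLHS](add0r (- x)) lev_add2rE pospart_ge0.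
  by rewrite subv_ge0 lev_joinl.
Qed.

Lemma supremums_uniq A s t : supremums A s -> supremums A t -> s = t.
Proof. by move=> [s1 s2] [t1 t2]; apply/le_anti; rewrite s2//= t2. Qed.

Lemma riesz_decomposition x y z : 0 <= x -> 0 <= y -> 0 <= z -> z <= x + y ->
  exists u v, [/\ 0 <= u, u <= x, 0 <= v, v <= y & z = u + v].
Proof.
move=> x0 y0 z0 zxy; exists (vmeet z x), (z - vmeet z x); split.
- by rewrite vmeetP z0.
- exact: vmeet_ler.
- by rewrite subv_ge0 vmeet_lel.
- rewrite lev_sublE addrC -lev_sublE vmeetP !lev_sublE.
  by rewrite -{1}(addr0 z) lev_add2lE y0.
- by rewrite addrC subrK.
Qed.


Lemma vmeet_ge0 x y : 0 <= x -> 0 <= y -> 0 <= vmeet x y.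
Proof. by move=> x0 y0; rewrite vmeetP x0. Qed.

Lemma modulusZ_le (a : R) x : modulus (a *: x) <= `|a| *: modulus x.
Proof.
have [a0|a0] := leP 0 a.
- rewrite ger0_norm//; apply: modulus_le; rewrite -?scalerN;
    by apply: lev_scale; rewrite ?le_modulus ?leN_modulus.
- rewrite ltr0_norm// -(modulusN (a *: x)) -scaleNr; apply: modulus_le;
    rewrite -?scalerN;
    by apply: lev_scale; rewrite ?oppr_ge0 ?(ltW a0) ?le_modulus ?leN_modulus.
Qed.

Lemma disjointP x y : disjoint_elts x y <->
  (forall z, z <= modulus x -> z <= modulus y -> z <= 0).
Proof.
split=> [xy z zx zy|h]; first by rewrite -xy vmeetP zx.
apply/le_anti; rewrite vmeet_ge0 ?modulus_ge0// andbT.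
by apply: h; [exact: vmeet_lel|exact: vmeet_ler].
Qed.

Lemma disjointD x1 x2 y :
  disjoint_elts x1 y -> disjoint_elts x2 y -> disjoint_elts (x1 + x2) y.
Proof.
move=> /disjointP d1 /disjointP d2.
apply/le_anti; rewrite vmeet_ge0 ?modulus_ge0// andbT.
set z := vmeet _ _.
have z0 : 0 <= z by rewrite vmeet_ge0 ?modulus_ge0.
have zx : z <= modulus x1 + modulus x2.
  by apply: le_trans (modulusD _ _); exact: vmeet_lel.
have zy : z <= modulus y by exact: vmeet_ler.
have [u [v [u0 ux v0 vx zE]]] :=
  riesz_decomposition (modulus_ge0 x1) (modulus_ge0 x2) z0 zx.
rewrite zE in zy *; rewrite -[0]addr0; apply: lev_add.
- by apply: d1 => //; apply: le_trans zy; rewrite -{1}(addr0 u) lev_add2lE.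
- by apply: d2 => //; apply: le_trans zy; rewrite -{1}(add0r v) lev_add2rE.
Qed.

Lemma disjointZ (a : R) x y : disjoint_elts x y -> disjoint_elts (a *: x) y.
Proof.
move=> /disjointP d; apply/disjointP => z zx zy.
pose k : R := Num.max 1 `|a|.
have k1 : 1 <= k by rewrite le_max lexx.
have k0 : 0 < k by apply: lt_le_trans k1.
have ki : 0 <= k^-1 by rewrite invr_ge0 ltW.
suff : k^-1 *: z <= 0.
  move=> /(lev_scale (ltW k0)).
  by rewrite scalerA divff ?gt_eqF// scale1r scaler0.
apply: d.
- have : z <= k *: modulus x.
    apply: (le_trans zx); apply: (le_trans (modulusZ_le _ _)).
    rewrite -subv_ge0 -scalerBl; apply: scalev_ge0; last exact: modulus_ge0.
    by rewrite subr_ge0 le_max lexx orbT.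
  move=> /(lev_scale ki).
  by rewrite scalerA mulVf ?gt_eqF// scale1r.
- apply: (le_trans (lev_scale ki zy)).
  rewrite -{2}(scale1r (modulus y)) -subv_ge0 -scalerBl.
  by apply: scalev_ge0; rewrite ?modulus_ge0// subr_ge0 invf_le1.
Qed.

Lemma disjoint_complD A x y : disjoint_compl A x -> disjoint_compl A y ->
  disjoint_compl A (x + y).
Proof. by move=> h1 h2 z Az; apply: disjointD; [exact: h1|exact: h2]. Qed.

Lemma disjoint_complZ A (a : R) x :
  disjoint_compl A x -> disjoint_compl A (a *: x).
Proof. by move=> h z Az; apply: disjointZ; exact: h. Qed.

Lemma disjoint_self x : disjoint_elts x x -> x = 0.
Proof.
move=> /disjointP h; apply/le_anti/andP.
have m0 : modulus x <= 0 by apply: h.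
split; first exact: le_trans (le_modulus x) m0.
by rewrite -oppv_le0; exact: le_trans (leN_modulus x) m0.
Qed.

Section Band.
Variables (B : set E) (hB : is_band B).

Lemma band0 : B 0. Proof. by case: hB => -[]. Qed.

Lemma bandZD (a : R) x y : B x -> B y -> B (a *: x + y).
Proof. by case: hB => -[] _ + _ _; exact. Qed.

Lemma bandD x y : B x -> B y -> B (x + y).
Proof. by rewrite -{2}(scale1r x); exact: bandZD. Qed.

Lemma bandZ (a : R) x : B x -> B (a *: x).
Proof.
by move=> Bx; rewrite -[_ *: _]addr0; apply: bandZD => //; exact: band0.
Qed.

Lemma bandN x : B x -> B (- x).
Proof. by rewrite -scaleN1r; exact: bandZ. Qed.

Lemma band_solid x y : modulus x <= modulus y -> B y -> B x.
Proof. by case: hB => -[] _ _ + _; exact. Qed.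

Lemma band_sup A s : A `<=` B -> supremums A s -> B s.
Proof. by case: hB => _; exact. Qed.

Lemma band_modulus x : B x -> B (modulus x).
Proof. by apply: band_solid; rewrite (ger0_modulus (modulus_ge0 x)). Qed.

Lemma band_between x y : 0 <= x -> x <= y -> B y -> B x.
Proof.
by move=> x0 xy; apply: band_solid; rewrite !ger0_modulus// (le_trans x0).
Qed.

Lemma band_join x y : B x -> B y -> B (vjoin x y).
Proof.
move=> Bx By; have -> : vjoin x y = x + pospart (y - x).
  apply/le_anti/andP; split.
    rewrite vjoinP -{1}(addr0 x) lev_add2lE pospart_ge0/= addrC -lev_sublE.
    exact: lev_joinl.
  rewrite addrC -lev_subrE /pospart vjoinP lev_add2rE lev_joinr/=.
  by rewrite subv_ge0 lev_joinl.
apply: bandD => //; apply: (@band_between _ (modulus (y - x))).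
- exact: pospart_ge0.
- by rewrite /pospart vjoinP le_modulus modulus_ge0.
- by apply: band_modulus; apply: bandD => //; exact: bandN.
Qed.

Lemma band_meet x y : B x -> B y -> B (vmeet x y).
Proof.
move=> Bx By; have -> : vmeet x y = - vjoin (- x) (- y).
  apply/le_anti/andP; split.
    by rewrite -lev_oppE opprK vjoinP !lev_oppE vmeet_lel vmeet_ler.
  by rewrite vmeetP -(lev_oppE x) -(lev_oppE y) opprK lev_joinl lev_joinr.
by apply: bandN; apply: band_join; exact: bandN.
Qed.

Lemma band_decomp_uniq x y y' :
  B y -> disjoint_compl B (x - y) -> B y' -> disjoint_compl B (x - y') ->
  y = y'.
Proof.
move=> By dy By' dy'; apply/eqP; rewrite -subr_eq0; apply/eqP/disjoint_self.
have Byy' : B (y - y') by apply: bandD => //; exact: bandN.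
suff d : disjoint_compl B (y - y') by exact: d.
have -> : y - y' = (x - y') + (-1) *: (x - y).
  by rewrite scaleN1r opprB [RHS]addrC addrA subrK.
exact: (disjoint_complD dy' (disjoint_complZ (-1) dy)).
Qed.

Lemma band_proj_uniq x y : B y -> disjoint_compl B (x - y) -> band_proj B x = y.
Proof.
move=> By dy; rewrite /band_proj; case: xgetP => [z _ [Bz dz]|/(_ y)].
  exact: band_decomp_uniq Bz dz By dy.
by move=> /(_ (conj By dy)).
Qed.

Lemma band_proj_mem x : B (band_proj B x).
Proof.
by rewrite /band_proj; case: xgetP => [z _ []//|_]; exact: band0.
Qed.

End Band.

(* Kantorovich: an additive and positively homogeneous map on the positive cone
   has a unique linear extension. *)
Definition cone_ext (p : E -> E) x : E := p (pospart x) - p (negpart x).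

Section ConeExt.
Variable p : E -> E.
Hypothesis pD : forall x y, 0 <= x -> 0 <= y -> p (x + y) = p x + p y.
Hypothesis pZle : forall (a : R) x,
  0 < a -> 0 <= x -> p (a *: x) <= a *: p x.

Let p0 : p 0 = 0.
Proof. by apply: (addrI (p 0)); rewrite -pD// !addr0. Qed.

Let pZ (a : R) x : 0 <= a -> 0 <= x -> p (a *: x) = a *: p x.
Proof.
rewrite le_eqVlt => /predU1P[<-|a0] x0; first by rewrite !scale0r.
apply/le_anti; rewrite pZle//=.
have a'0 : 0 < a^-1 by rewrite invr_gt0.
have ax0 : 0 <= a *: x by exact: scalev_ge0 (ltW a0) x0.
move: (lev_scale (ltW a0) (pZle a'0 ax0)).
by rewrite !scalerA mulVf ?divff ?gt_eqF// !scale1r.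
Qed.

Lemma cone_extB x y : 0 <= x -> 0 <= y -> cone_ext p (x - y) = p x - p y.
Proof.
move=> x0 y0; apply/eqP; rewrite subr_eq addrAC eq_sym subr_eq; apply/eqP.
rewrite -!pD ?pospart_ge0 ?negpart_ge0//; congr p.
apply/eqP; rewrite -subr_eq addrAC eq_sym -subr_eq eq_sym.
by rewrite pospartBnegpart.
Qed.

Lemma cone_ext_pos x : 0 <= x -> cone_ext p x = p x.
Proof.
by move=> x0; rewrite -{1}(subr0 x) cone_extB// p0 subr0.
Qed.

Lemma cone_ext_linear : linear (cone_ext p).
Proof.
move=> a x y.
have [px nx] := (pospart_ge0 x, negpart_ge0 x).
have [py ny] := (pospart_ge0 y, negpart_ge0 y).
have [a0|a0] := leP 0 a.
- have -> : a *: x + y = (a *: pospart x + pospart y)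
                       - (a *: negpart x + negpart y).
    by rewrite opprD addrACA -scalerBr !pospartBnegpart.
  rewrite cone_extB ?addv_ge0 ?scalev_ge0// !pD ?scalev_ge0// !pZ//.
  by rewrite opprD addrACA -scalerBr.
- have b0 : 0 <= - a by rewrite oppr_ge0 ltW.
  have -> : a *: x + y = (- a *: negpart x + pospart y)
                       - (- a *: pospart x + negpart y).
    rewrite opprD addrACA -scalerBr pospartBnegpart scaleNr -scalerN opprB.
    by rewrite pospartBnegpart.
  rewrite cone_extB ?addv_ge0 ?scalev_ge0// !pD ?scalev_ge0// !pZ//.
  by rewrite opprD addrACA -scalerBr scaleNr -scalerN opprB.
Qed.

End ConeExt.

End VectorLatticeTheory.

Section BandProjection.
Context {R : realType} {E : ocVectorLatticeType R}.
Variables (B : set E) (hB : is_band B).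
Implicit Types x y z : E.

Lemma band_decomp_ge0 x : 0 <= x ->
  exists y, [/\ B y, disjoint_compl B (x - y), 0 <= y & y <= x].
Proof.
move=> x0; pose A := [set y | [/\ B y, 0 <= y & y <= x]].
have A0 : A 0 by split => //; exact: band0.
have [s [sub slb]] : supremums A !=set0.
  by apply: order_complete; split; [exists 0|exists x => y []].
have Bs : B s by apply: (@band_sup _ _ _ hB A) => // y [].
have s0 : 0 <= s by exact: sub.
have sx : s <= x by apply: slb => y [].
exists s; split=> // b Bb; apply/le_anti/andP.
have m0 : 0 <= vmeet (modulus (x - s)) (modulus b).
  by rewrite vmeet_ge0 ?modulus_ge0.
split=> //; set z := vmeet _ _ in m0 *.
have Bz : B z.
  by apply: (band_between hB m0 (vmeet_ler _ _)); exact: band_modulus.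
have zx : z <= x - s.
  by rewrite -[leRHS]ger0_modulus ?subv_ge0//; exact: vmeet_lel.
rewrite -(lev_add2rE s) add0r; apply: sub; split.
- exact: bandD.
- exact: addv_ge0.
- by rewrite -lev_subrE.
Qed.

Lemma band_decomp x : exists y, B y /\ disjoint_compl B (x - y).
Proof.
have [y1 [B1 d1 _ _]] := band_decomp_ge0 (pospart_ge0 x).
have [y2 [B2 d2 _ _]] := band_decomp_ge0 (negpart_ge0 x).
exists (y1 - y2); split; first by apply: bandD => //; exact: bandN.
have -> : x - (y1 - y2) = (pospart x - y1) + (-1) *: (negpart x - y2).
  by rewrite scaleN1r !opprD addrACA pospartBnegpart.
by apply: disjoint_complD => //; exact: disjoint_complZ.
Qed.

Lemma band_projP x :
  B (band_proj B x) /\ disjoint_compl B (x - band_proj B x).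
Proof.
by have [y [By dy]] := band_decomp x; rewrite (band_proj_uniq hB By dy).
Qed.

Lemma band_proj_linear : linear (band_proj B).
Proof.
move=> a x y; have [Bx dx] := band_projP x; have [By dy] := band_projP y.
apply: (band_proj_uniq hB); first exact: bandZD.
rewrite opprD addrACA -scalerBr.
by apply: disjoint_complD => //; exact: disjoint_complZ.
Qed.

Lemma band_proj_ge0 x : 0 <= x -> 0 <= band_proj B x.
Proof.
move=> x0; have [y [By dy y0 _]] := band_decomp_ge0 x0.
by rewrite (band_proj_uniq hB By dy).
Qed.

Lemma band_proj_id x : B x -> band_proj B x = x.
Proof.
move=> Bx; apply: (band_proj_uniq hB) => // b _; rewrite subrr.
by apply/disjointP => z; rewrite modulus0.
Qed.

End BandProjection.

Record band_of (R : realType) (E : ocVectorLatticeType R) := Band {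
  band_set :> set E;
  bandP : is_band band_set
}.

Record band_space (R : realType) (E : ocVectorLatticeType R) (B : band_of E) :=
  BandSpace { band_val :> E; _ : band_val \in band_set B }.

HB.instance Definition _ (R : realType) (E : ocVectorLatticeType R)
  (B : band_of E) := [isSub for @band_val R E B].
HB.instance Definition _ (R : realType) (E : ocVectorLatticeType R)
  (B : band_of E) := [Choice of band_space B by <:].

Section BandSpace.
Context {R : realType} {E : ocVectorLatticeType R} {B : band_of E}.

Fact band_submod_closed :
  GRing.subsemimod_closed (fun x : E => x \in band_set B).
Proof.
have hB := bandP B; split; first split.
- by apply/mem_set; exact: band0 hB.
- by move=> x y /set_mem Bx /set_mem By; apply/mem_set; exact: bandD.
- by move=> a x /set_mem Bx; apply/mem_set; exact: bandZ.
Qed.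

HB.instance Definition _ := GRing.SubChoice_isSubLmodule.Build R E
  (fun x : E => x \in band_set B) (band_space B) band_submod_closed.
End BandSpace.

Section BandSpaceOrder.
Context {R : realType} {E : ocVectorLatticeType R} {B : band_of E}.
Implicit Types u v w : band_space B.

HB.instance Definition _ :=
  [SubChoice_isSubPOrder of band_space B by <: with ring_display].

Lemma band_space_leE u v : (u <= v) = (val u <= val v :> E).
Proof. by []. Qed.

Fact band_space_add2r w u v : u <= v -> u + w <= v + w.
Proof. by rewrite !band_space_leE !raddfD; exact: lev_add2r. Qed.

Fact band_space_scale_ge0 (a : R) u : 0 <= a -> 0 <= u -> 0 <= a *: u.
Proof. by rewrite !band_space_leE !raddf0; exact: scalev_ge0. Qed.

Lemma band_valP u : band_set B (val u).
Proof. exact/set_mem/(valP u). Qed.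

Definition band_space_join u v : band_space B :=
  BandSpace (mem_set (band_join (bandP B) (band_valP u) (band_valP v))).
Definition band_space_meet u v : band_space B :=
  BandSpace (mem_set (band_meet (bandP B) (band_valP u) (band_valP v))).

Fact band_space_joinP u v w :
  (band_space_join u v <= w) = (u <= w) && (v <= w).
Proof. exact: vjoinP. Qed.

Fact band_space_meetP u v w :
  (u <= band_space_meet v w) = (u <= v) && (u <= w).
Proof. exact: vmeetP. Qed.

HB.instance Definition _ := isVectorLattice.Build R (band_space B)
  band_space_add2r band_space_scale_ge0 band_space_joinP band_space_meetP.

Fact band_space_order_complete (A : set (band_space B)) :
  has_sup A -> supremums A !=set0.
Proof.
move=> [[u Au] [v Av]].
have [s [sub slb]] : supremums (val @` A : set E) !=set0.
  apply: order_complete; split; first by exists (val u), u.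
  by exists (val v) => _ [w Aw <-]; exact: Av.
have Bs : band_set B s.
  apply: (@band_sup _ _ _ (bandP B) (val @` A)) => // _ [w _ <-].
  exact: band_valP.
exists (BandSpace (mem_set Bs)); split=> [w Aw|w Aw].
  by apply: sub; exists w.
by apply: slb => _ [w' Aw' <-]; exact: Aw.
Qed.

HB.instance Definition _ :=
  isOrderComplete.Build R (band_space B) band_space_order_complete.
End BandSpaceOrder.

Record Lr (R : realType) (E : ocVectorLatticeType R) :=
  RegOp { reg_fun :> E -> E; _ : `[< regular_op reg_fun >] }.

HB.instance Definition _ (R : realType) (E : ocVectorLatticeType R) :=
  [isSub for @reg_fun R E].
HB.instance Definition _ (R : realType) (E : ocVectorLatticeType R) :=
  [Choice of Lr E by <:].

Section RegularOperators.
Context {R : realType} {E : ocVectorLatticeType R}.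
Implicit Types (x y z : E) (S T U V W : Lr E) (f g : E -> E).

Lemma lin0_op f : linear f -> f 0 = 0.
Proof.
move=> lf; have := lf (-1) 0 0.
by rewrite scaleN1r oppr0 add0r scaleN1r addNr.
Qed.

Lemma linD_op f : linear f -> forall x y, f (x + y) = f x + f y.
Proof. by move=> lf x y; have := lf 1 x y; rewrite !scale1r. Qed.

Lemma linZ_op f : linear f -> forall (a : R) x, f (a *: x) = a *: f x.
Proof.
by move=> lf a x; have := lf a x 0; rewrite !addr0 (lin0_op lf) addr0.
Qed.

Lemma linB_op f : linear f -> forall x y, f (x - y) = f x - f y.
Proof. by move=> lf x y; rewrite linD_op// -scaleN1r linZ_op// scaleN1r. Qed.

Lemma positive_opD f g : positive_op f -> positive_op g -> positive_op (f + g).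
Proof.
move=> [lf pf] [lg pg]; split=> [a x y|x x0].
  by rewrite !fctE lf lg scalerDr addrACA.
by rewrite fctE; apply: addv_ge0; [exact: pf|exact: pg].
Qed.

Lemma positive_opZ (a : R) f : 0 <= a -> positive_op f -> positive_op (a *: f).
Proof.
move=> a0 [lf pf]; split=> [b x y|x x0].
  by rewrite !fctE lf scalerDr !scalerA mulrC.
by rewrite fctE; apply: scalev_ge0 => //; exact: pf.
Qed.

Lemma positive_op0 : positive_op (0 : E -> E).
Proof.
split=> [a x y|x _]; last exact: lexx.
by change (0 = a *: (0 : E) + 0); rewrite scaler0 addr0.
Qed.

Lemma positive_op_regular f : positive_op f -> regular_op f.
Proof.
by move=> pf; exists f, 0; rewrite subr0; split=> //; exact: positive_op0.
Qed.

Lemma regular_op_linear f : regular_op f -> linear f.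
Proof.
move=> [U [V [[lU _] [lV _] ->]]] a x y.
by rewrite !fctE lU lV opprD addrACA scalerBr.
Qed.

Lemma regular_op0 : regular_op (0 : E -> E).
Proof. exact/positive_op_regular/positive_op0. Qed.

Lemma regular_opD f g : regular_op f -> regular_op g -> regular_op (f + g).
Proof.
move=> [U [V [pU pV ->]]] [U' [V' [pU' pV' ->]]].
exists (U + U'), (V + V'); split; [exact: positive_opD|exact: positive_opD|].
by rewrite opprD addrACA.
Qed.

Lemma regular_opN f : regular_op f -> regular_op (- f).
Proof. by move=> [U [V [pU pV ->]]]; exists V, U; rewrite opprB. Qed.

Lemma regular_opZ (a : R) f : regular_op f -> regular_op (a *: f).
Proof.
have pos b g : 0 <= b -> regular_op g -> regular_op (b *: g).
  move=> b0 [U [V [pU pV ->]]]; exists (b *: U), (b *: V).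
  by rewrite scalerBr; split=> //; exact: positive_opZ.
have [a0|/ltW a0] := leP 0 a; first exact: pos.
move=> rf; rewrite -[a]opprK scaleNr; apply: regular_opN.
by apply: pos => //; rewrite oppr_ge0.
Qed.

Fact Lr_submod_closed :
  GRing.subsemimod_closed (fun f : E -> E => `[< regular_op f >]).
Proof.
split; first split.
- exact/asboolP/regular_op0.
- by move=> f g /asboolP rf /asboolP rg; apply/asboolP; exact: regular_opD.
- by move=> a f /asboolP rf; apply/asboolP; exact: regular_opZ.
Qed.

HB.instance Definition _ := GRing.SubChoice_isSubLmodule.Build R (E -> E)
  (fun f : E -> E => `[< regular_op f >]) (Lr E) Lr_submod_closed.

Definition mk_reg (f : E -> E) (rf : regular_op f) : Lr E :=
  RegOp (introT (asboolP _) rf).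

Lemma Lr_regular T : regular_op T.
Proof. by case: T => f /= /asboolP. Qed.

Lemma Lr_linear T : linear T.
Proof. exact/regular_op_linear/Lr_regular. Qed.

Lemma LrDE S T x : (S + T) x = S x + T x. Proof. by []. Qed.
Lemma LrNE T x : (- T) x = - T x. Proof. by []. Qed.
Lemma LrZE (a : R) T x : (a *: T) x = a *: T x. Proof. by []. Qed.
Lemma Lr0E x : (0 : Lr E) x = 0. Proof. by []. Qed.

Lemma Lr_ext_pos S T : (forall x, 0 <= x -> S x = T x) -> S = T.
Proof.
move=> ST; apply/val_inj/funext => x /=.
rewrite -(pospartBnegpart x) (linB_op (Lr_linear S)) (linB_op (Lr_linear T)).
by rewrite !ST ?pospart_ge0 ?negpart_ge0.
Qed.

Definition Lr_le S T : bool := `[< forall x, 0 <= x -> S x <= T x >].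

Fact Lr_le_refl : reflexive Lr_le.
Proof. by move=> T; apply/asboolP. Qed.

Fact Lr_le_anti : antisymmetric Lr_le.
Proof.
move=> S T /andP[/asboolP ST /asboolP TS]; apply: Lr_ext_pos => x x0.
by apply/le_anti; rewrite ST// TS.
Qed.

Fact Lr_le_trans : transitive Lr_le.
Proof.
move=> T S U /asboolP ST /asboolP TU; apply/asboolP => x x0.
by apply: (le_trans (ST x x0)); exact: TU.
Qed.

HB.instance Definition _ := Order.Le_isPOrder.Build ring_display (Lr E)
  Lr_le_refl Lr_le_anti Lr_le_trans.

Lemma Lr_leP S T : (S <= T) <-> (forall x, 0 <= x -> S x <= T x).
Proof. by split=> [/asboolP|?]; last exact/asboolP. Qed.

Fact Lr_add2r W S T : S <= T -> S + W <= T + W.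
Proof.
move=> /Lr_leP ST; apply/Lr_leP => x x0; rewrite !LrDE.
by apply: lev_add2r; exact: ST.
Qed.

Fact Lr_scale_ge0 (a : R) T : 0 <= a -> 0 <= T -> 0 <= a *: T.
Proof.
move=> a0 /Lr_leP T0; apply/Lr_leP => x x0.
by apply: scalev_ge0 => //; exact: T0.
Qed.

Lemma Lr_pos T : 0 <= T -> positive_op T.
Proof. by move=> /Lr_leP T0; split; [exact: Lr_linear|exact: T0]. Qed.

Lemma riesz_kantorovich T : exists P : Lr E,
  [/\ 0 <= P, T <= P & forall W, 0 <= W -> T <= W -> P <= W].
Proof.
have lT := Lr_linear T.
have [U [V [[lU pU] [lV pV] TE]]] := Lr_regular T.
pose A x : set E := [set t | exists y, [/\ 0 <= y, y <= x & t = T y]].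
pose p x : E := xget 0 (supremums (A x)).
have ps x : 0 <= x -> supremums (A x) (p x).
  move=> x0; have : supremums (A x) !=set0.
    apply: order_complete; split; first by exists (T 0), 0.
    exists (U x) => _ [y [y0 yx ->]]; rewrite TE fctE lev_sublE.
    rewrite -[leLHS]addr0; apply: lev_add; last exact: pV.
    by rewrite -subv_ge0 -linB_op//; apply: pU; rewrite subv_ge0.
  by move=> [s hs]; rewrite /p; case: xgetP => // /(_ s).
have pub x y : 0 <= y -> y <= x -> T y <= p x.
  move=> y0 yx; have [+ _] := ps _ (le_trans y0 yx).
  by apply; exists y.
have plb x z : 0 <= x -> (forall y, 0 <= y -> y <= x -> T y <= z) -> p x <= z.
  move=> x0 h; have [_ +] := ps _ x0; apply => _ [y [y0 yx ->]].
  exact: h.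
have pD x y : 0 <= x -> 0 <= y -> p (x + y) = p x + p y.
  move=> x0 y0; apply/le_anti/andP; split.
    apply: (plb); first exact: addv_ge0.
    move=> z z0 zxy.
    have [u [v [u0 ux v0 vy ->]]] := riesz_decomposition x0 y0 z0 zxy.
    by rewrite linD_op//; apply: lev_add; exact: (pub).
  rewrite -lev_subrE; apply: (plb) => // u u0 ux.
  rewrite lev_subrE addrC -lev_subrE; apply: (plb) => // v v0 vy.
  rewrite lev_subrE -linD_op//; apply: (pub); first exact: addv_ge0.
  by rewrite addrC; exact: lev_add.
have pZle (a : R) x : 0 < a -> 0 <= x -> p (a *: x) <= a *: p x.
  move=> a0 x0; have ai : 0 <= a^-1 by rewrite invr_ge0 ltW.
  apply: (plb); first exact: scalev_ge0 (ltW a0) x0.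
  move=> y y0 yx.
  have -> : y = a *: (a^-1 *: y) by rewrite scalerA divff ?gt_eqF// scale1r.
  rewrite linZ_op//; apply: lev_scale (ltW a0) _; apply: (pub).
    exact: scalev_ge0.
  by move: (lev_scale ai yx); rewrite scalerA mulVf ?gt_eqF// scale1r.
have pos : positive_op (cone_ext p).
  split; first exact: cone_ext_linear pD pZle.
  move=> x x0; rewrite cone_ext_pos// -(lin0_op lT).
  exact: (pub).
exists (mk_reg (positive_op_regular pos)); split.
- by apply/Lr_leP; exact: pos.2.
- by apply/Lr_leP => x x0 /=; rewrite cone_ext_pos//; exact: (pub).
- move=> W /Lr_pos[lW pW] /Lr_leP TW; apply/Lr_leP => x x0 /=.
  rewrite cone_ext_pos//; apply: (plb) => // y y0 yx.
  apply: (le_trans (TW _ y0)).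
  by rewrite -subv_ge0 -linB_op//; apply: pW; rewrite subv_ge0.
Qed.

Definition Lr_pospart T : Lr E := projT1 (cid (riesz_kantorovich T)).
Definition Lr_join S T : Lr E := S + Lr_pospart (T - S).
Definition Lr_meet S T : Lr E := - Lr_join (- S) (- T).

Let Lr_add2rE W S T : (S + W <= T + W) = (S <= T).
Proof.
apply/idP/idP => [h|]; last exact: Lr_add2r.
by rewrite -[S](addrK W) -[T](addrK W); exact: Lr_add2r.
Qed.

Fact Lr_joinP S T W : (Lr_join S T <= W) = (S <= W) && (T <= W).
Proof.
rewrite /Lr_join /Lr_pospart; case: cid => P /= [P0 TP lb].
have shift U V : (U + V <= W) = (V <= W - U).
  by rewrite -(Lr_add2rE U V) subrK addrC.
apply/idP/andP => [h|[SW TW]].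
- split.
    by apply: (le_trans _ h); rewrite -(Lr_add2rE (- S)) subrr addrC addKr.
  apply: (le_trans _ h); rewrite -(Lr_add2rE (- S)) (addrC S) addrK.
  exact: TP.
- rewrite shift; apply: lb.
    by rewrite -(Lr_add2rE S 0) add0r subrK.
  by rewrite Lr_add2rE.
Qed.

Fact Lr_meetP S T W : (S <= Lr_meet T W) = (S <= T) && (S <= W).
Proof.
have opp U V : (- U <= - V) = (V <= U).
  by rewrite -(Lr_add2rE (U + V) (- U)) addKr (addrC U) addKr.
by rewrite /Lr_meet -opp opprK Lr_joinP !opp.
Qed.

HB.instance Definition _ := isVectorLattice.Build R (Lr E)
  Lr_add2r Lr_scale_ge0 Lr_joinP Lr_meetP.

Fact Lr_order_complete (A : set (Lr E)) : has_sup A -> supremums A !=set0.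
Proof.
move=> [[T0 AT0] [W AW]].
(* closure of A under binary suprema, which is directed *)
pose D : set (Lr E) := [set T | forall X : set (Lr E), A `<=` X ->
  (forall S S', X S -> X S' -> X (vjoin S S')) -> X T].
have AD : A `<=` D by move=> T AT X AX _; exact: AX.
have Dj S T : D S -> D T -> D (vjoin S T).
  by move=> DS DT X AX jX; apply: (jX); [exact: DS|exact: DT].
have Dub V : ubound A V -> ubound D V.
  move=> AV T DT; apply: (DT [set T | T <= V]) => // S S' /= SV S'V.
  by rewrite vjoinP SV.
pose p x : E := xget 0 (supremums [set T x | T in D]).
have ps x : 0 <= x -> supremums [set T x | T in D] (p x).
  move=> x0; have : supremums [set T x | T in D] !=set0.
    apply: order_complete; split; first by exists (T0 x), T0 => //; exact: AD.
    by exists (W x) => _ [T DT <-]; have /Lr_leP := Dub _ AW _ DT; exact.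
  by move=> [s hs]; rewrite /p; case: xgetP => // /(_ s).
have pub x T : 0 <= x -> D T -> T x <= p x.
  by move=> x0 DT; have [+ _] := ps _ x0; apply; exists T.
have plb x z : 0 <= x -> (forall T, D T -> T x <= z) -> p x <= z.
  by move=> x0 h; have [_ +] := ps _ x0; apply => _ [T DT <-]; exact: h.
have pD x y : 0 <= x -> 0 <= y -> p (x + y) = p x + p y.
  move=> x0 y0; have xy0 := addv_ge0 x0 y0; apply/le_anti/andP; split.
    apply: (plb) => // T DT.
    by rewrite (linD_op (Lr_linear T)); apply: lev_add; exact: (pub).
  rewrite -lev_subrE; apply: (plb) => // S DS.
  rewrite lev_subrE addrC -lev_subrE; apply: (plb) => // T DT.
  rewrite lev_subrE addrC; apply: le_trans (pub _ _ xy0 (Dj _ _ DS DT)).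
  rewrite (linD_op (Lr_linear _)); apply: lev_add.
    by have /Lr_leP := lev_joinl S T; exact.
  by have /Lr_leP := lev_joinr S T; exact.
have pZle (a : R) x : 0 < a -> 0 <= x -> p (a *: x) <= a *: p x.
  move=> a0 x0; apply: (plb); first exact: scalev_ge0 (ltW a0) x0.
  move=> T DT; rewrite (linZ_op (Lr_linear T)).
  by apply: lev_scale (ltW a0) _; exact: (pub).
have lp : linear (cone_ext p) by exact: cone_ext_linear pD pZle.
have rp : regular_op (cone_ext p).
  have -> : cone_ext p = (cone_ext p - T0) + T0 by rewrite subrK.
  apply: regular_opD (Lr_regular T0); apply: positive_op_regular; split.
    move=> a x y; change (cone_ext p (a *: x + y) - T0 (a *: x + y) =
      a *: (cone_ext p x - T0 x) + (cone_ext p y - T0 y)).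
    rewrite lp (Lr_linear T0).
    by rewrite opprD addrACA -scalerBr.
  move=> x x0; rewrite fctE subv_ge0 cone_ext_pos//.
  by apply: (pub) => //; exact: AD.
exists (mk_reg rp); split=> [T AT|V AV]; apply/Lr_leP => x x0 /=;
  rewrite cone_ext_pos//.
- by apply: (pub) => //; exact: AD.
- by apply: (plb) => // T DT; have /Lr_leP := Dub _ AV _ DT; exact.
Qed.

HB.instance Definition _ :=
  isOrderComplete.Build R (Lr E) Lr_order_complete.

End RegularOperators.

Arguments mk_reg {R E} f rf.

Section Diagonal.
Context {R : realType} {E : ocVectorLatticeType R}.

Definition Orth : set (Lr E) := [set T | orthomorphism T].

Definition orth_diag (T : Lr E) : Lr E := band_proj Orth T.

End Diagonal.

Section BandDiagonal.
Context {R : realType} {E : ocVectorLatticeType R} (B : band_of E).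

Definition to_band (x : E) : band_space B :=
  BandSpace (mem_set (band_proj_mem (bandP B) x)).

Definition compression_fun (T : E -> E) : band_space B -> band_space B :=
  fun u => to_band (T (band_proj B (val u))).

Definition extension_fun (S : band_space B -> band_space B) : E -> E :=
  fun x => val (S (to_band x)).

Lemma to_band_linear (a : R) x y :
  to_band (a *: x + y) = a *: to_band x + to_band y.
Proof. by apply: val_inj => /=; rewrite (band_proj_linear (bandP B)). Qed.

Lemma to_bandB x y : to_band (x - y) = to_band x - to_band y.
Proof. by rewrite addrC -scaleN1r to_band_linear scaleN1r addrC. Qed.

Lemma to_band_ge0 x : 0 <= x -> 0 <= to_band x.
Proof. by move=> x0; exact: (band_proj_ge0 (bandP B)). Qed.

Lemma compression_positive T : positive_op T -> positive_op (compression_fun T).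
Proof.
move=> [lT pT]; split=> [a u v|u u0].
  rewrite /compression_fun -to_band_linear -lT.
  by rewrite -(band_proj_linear (bandP B)).
apply: to_band_ge0; apply: pT; apply: (band_proj_ge0 (bandP B)).
exact: u0.
Qed.

Lemma extension_positive S : positive_op S -> positive_op (extension_fun S).
Proof.
move=> [lS pS]; split=> [a x y|x x0].
  by rewrite /extension_fun to_band_linear lS.
by have := pS _ (to_band_ge0 x0).
Qed.

Lemma compression_regular T : regular_op T -> regular_op (compression_fun T).
Proof.
move=> [U [V [pU pV ->]]]; exists (compression_fun U), (compression_fun V).
split; [exact: compression_positive|exact: compression_positive|].
by apply/funext => u; exact: to_bandB.
Qed.

Lemma extension_regular S : regular_op S -> regular_op (extension_fun S).
Proof.
move=> [U [V [pU pV ->]]]; exists (extension_fun U), (extension_fun V).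
by split; [exact: extension_positive|exact: extension_positive|].
Qed.

Definition compression (T : Lr E) : Lr (band_space B) :=
  mk_reg (compression_fun T) (compression_regular (Lr_regular T)).

Definition extension (S : Lr (band_space B)) : Lr E :=
  mk_reg (extension_fun S) (extension_regular (Lr_regular S)).

Lemma extension_band (S : Lr (band_space B)) (u : band_space B) :
  extension S (val u) = val (S u).
Proof.
congr (val (S _)); apply: val_inj => /=.
exact: (band_proj_id (bandP B) (band_valP u)).
Qed.

Lemma extension_disjoint_compl (S : Lr (band_space B)) x :
  disjoint_compl (band_set B) x -> extension S x = 0.
Proof.
move=> dx; have x0 : to_band x = 0.
  apply: val_inj => /=; apply: (band_proj_uniq (bandP B)).
    exact: band0 (bandP B).
  by rewrite subr0.
by change (val (S (to_band x)) = 0); rewrite x0 (lin0_op (Lr_linear S)).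
Qed.

(* By [extension_band] and [extension_disjoint_compl], [extension S] is S on B
   and 0 on B^d. *)
Definition band_diag (T : Lr E) : Lr E :=
  extension (orth_diag (compression T)).

End BandDiagonal.

(* Main.v *)
Require Import Defs.
From mathcomp Require Import all_boot all_order all_algebra.
From mathcomp Require Import boolp classical_sets functions reals.

Local Open Scope classical_set_scope.

(** Write [D] for the diagonal map [orth_diag] and [D_B] for [band_diag B].
    The set in question is the kernel of the linear map [D - D_B], and the
    whole argument rests on one principle ([ker_band]): the kernel of a linear
    map [Q] of a vector lattice into itself is a band as soon as
    [0 <= Q x <= x] for all [x >= 0].

    The principle is used twice.  First, an operator [T] leaves a band [A]
    invariant exactly when its off-diagonal block [(1 - P_A) T P_A] vanishes,
    and [T |-> (1 - P_A) T P_A] satisfies the hypotheses on [Q].  Hence the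
    regular operators leaving [A] invariant form a band, and [Orth], their
    intersection over all [A], is a band ([Orth_band]); so [D] is a genuine
    band projection, and [S = D S <= D T] for every orthomorphism [S <= T].

    Second, for [0 <= T] the operator [D_B T] is positive, lies below
    [P_B T P_B <= T], and is an orthomorphism of [E], because a band of [E]
    traces a band on [B] ([band_trace]).  Therefore [0 <= D_B T <= D T <= T],
    that is [0 <= (D - D_B) T <= T], and the principle applies to [D - D_B]. *)

Section Bands.
Import Order.TTheory GRing.Theory Num.Theory.
Local Open Scope ring_scope.

(** * Kernels of positive maps dominated by the identity *)

Section Kernels.
Context {R : realType} {V : vectorLatticeType R}.
Implicit Types (x y : V) (A : set V).

Lemma positive_monotone (Q : V -> V) :
  linear Q -> (forall x, 0 <= x -> 0 <= Q x) ->
  forall x y, x <= y -> Q x <= Q y.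
Proof.
move=> lQ Q0 x y xy; rewrite -subv_ge0.
have -> : Q y - Q x = Q (y - x) by rewrite addrC -scaleN1r -lQ scaleN1r addrC.
by apply: Q0; rewrite subv_ge0.
Qed.

(** A supremum of the empty set is a least element, so it lies below its own
    translates. This settles the case of arguments about suprema in which no
    member of the set is available for comparison. *)
Lemma supremum_set0 (s : V) : supremums set0 s -> s = 0.
Proof.
move=> [_ lb]; have bot x : s <= x by apply: lb => y [].
apply/le_anti; rewrite bot/=.
by rewrite -[0](subrr s) lev_sublE bot.
Qed.

(** Solidity: if [Q y = 0] then [1 - Q], being positive, gives
    [`|y| = `|y - Q y| <= `|y| - Q `|y|], so that [Q] kills [`|y|] and hence
    every element dominated by it.  Suprema: if [Q] vanishes on [A] and
    [s = sup A], then [0 <= Q (s - a) = Q s] for [a] in [A], while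
    [a = a - Q a <= s - Q s] for all such [a], so [s <= s - Q s]. *)
Lemma ker_band (Q : V -> V) : linear Q -> (forall x, 0 <= x -> 0 <= Q x) ->
  (forall x, 0 <= x -> Q x <= x) -> is_band [set x | Q x = 0].
Proof.
move=> lQ Q0 Q1; have le := positive_monotone Q lQ Q0.
have QD x y : Q (x + y) = Q x + Q y by have := lQ 1 x y; rewrite !scale1r.
have Q00 : Q 0 = 0 by apply: (addrI (Q 0)); rewrite -QD !addr0.
have QN x : Q (- x) = - Q x by apply/eqP; rewrite -addr_eq0 -QD addNr Q00.
have IQ x y : x <= y -> x - Q x <= y - Q y.
  move=> xy; rewrite -subv_ge0.
  have -> : y - Q y - (x - Q x) = (y - x) - Q (y - x).
    by rewrite QD QN !opprD !opprK addrACA.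
  by rewrite subv_ge0; apply: Q1; rewrite subv_ge0.
split; first split.
- exact: Q00.
- by move=> a x y /= Qx Qy; rewrite lQ Qx Qy scaler0 addr0.
- move=> x y xy /= Qy.
  have Qm : Q (modulus y) <= 0.
    rewrite -oppv_ge0 -(lev_add2lE (modulus y)) addr0.
    apply: modulus_le.
      by have := IQ _ _ (le_modulus y); rewrite Qy subr0.
    by have := IQ _ _ (leN_modulus y); rewrite QN Qy oppr0 subr0.
  have Qx : Q (modulus x) <= 0 by apply: le_trans Qm; exact: le.
  apply/le_anti/andP; split; first exact: le_trans (le _ _ (le_modulus x)) Qx.
  rewrite -oppv_le0 -QN.
  exact: le_trans (le _ _ (leN_modulus x)) Qx.
- move=> A s AQ sA; have [A0|/set0P[a Aa]] := eqVneq A set0.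
    by move: sA; rewrite A0 => /supremum_set0 ->.
  have [ub lb] := sA; apply/le_anti/andP; split.
    rewrite -oppv_ge0 -(lev_add2lE s) addr0; apply: lb => b Ab.
    by have := IQ _ _ (ub b Ab); rewrite (AQ b Ab) subr0.
  by rewrite -(AQ a Aa); apply: le; exact: ub.
Qed.

Lemma bigcap_band (I : Type) (D : set I) (F : I -> set V) :
  (forall i, D i -> is_band (F i)) -> is_band (\bigcap_(i in D) F i).
Proof.
move=> hF; split; first split.
- by move=> i Di; exact: band0 (hF i Di).
- move=> a x y hx hy i Di.
  by apply: (bandZD (hF i Di)); [exact: hx|exact: hy].
- by move=> x y xy hy i Di; apply: (band_solid (hF i Di) xy); exact: hy.
- move=> A s AF sA i Di; apply: (band_sup (hF i Di) _ sA).
  by move=> x Ax; exact: AF.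
Qed.

End Kernels.

(** * The band of orthomorphisms *)

Section Orthomorphisms.
Context {R : realType} {E : ocVectorLatticeType R}.
Implicit Types (x y : E) (S T : Lr E) (A : set E).

Lemma band_proj_le A x : is_band A -> 0 <= x -> band_proj A x <= x.
Proof.
move=> hA x0; have [y [Ay dy _ yx]] := band_decomp_ge0 hA x0.
by rewrite (band_proj_uniq hA Ay dy).
Qed.

Lemma regular_op_sandwich (p q f : E -> E) : positive_op p -> positive_op q ->
  regular_op f -> regular_op (q \o f \o p).
Proof.
move=> [lp pp] [lq pq].
have pos g : positive_op g -> positive_op (q \o g \o p).
  by move=> [lg pg]; split=> [a x y|x x0] /=;
    [rewrite lp lg lq|apply/pq/pg/pp].
move=> [U [W [pU pW ->]]]; exists (q \o U \o p), (q \o W \o p).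
split; [exact: pos|exact: pos|].
by apply/funext => x; exact: (linB_op lq).
Qed.

Lemma band_proj_positive A : is_band A -> positive_op (band_proj A).
Proof.
by move=> hA; split; [exact: band_proj_linear|exact: band_proj_ge0].
Qed.

Lemma band_coproj_positive A : is_band A ->
  positive_op (fun x => x - band_proj A x).
Proof.
move=> hA; split=> [a x y|x x0]; last by rewrite subv_ge0 band_proj_le.
by rewrite (band_proj_linear hA) opprD addrACA -scalerBr.
Qed.

(** The block of [T] mapping [A] into the complement of [A]. *)
Definition off_diag A (hA : is_band A) T : Lr E :=
  mk_reg _ (regular_op_sandwich _ _ _
    (band_proj_positive _ hA) (band_coproj_positive _ hA) (Lr_regular T)).

Lemma off_diagE A (hA : is_band A) T x : off_diag A hA T x =
  T (band_proj A x) - band_proj A (T (band_proj A x)).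
Proof. by []. Qed.

Lemma off_diag_eq0 A (hA : is_band A) T :
  off_diag A hA T = 0 <-> (forall x, A x -> A (T x)).
Proof.
split=> [T0 x Ax|TA].
  have : off_diag A hA T x = 0 by rewrite T0.
  rewrite off_diagE (band_proj_id hA Ax) => /subr0_eq ->.
  exact: band_proj_mem.
apply: Lr_ext_pos => x _; rewrite off_diagE.
have ATP : A (T (band_proj A x)) by apply: TA; exact: band_proj_mem.
by rewrite (band_proj_id hA ATP) subrr.
Qed.

(** Invariance of one band is a vanishing condition on a single off-diagonal
    block, and for positive [T] this block is dominated by [T]; this avoids any
    formula for the modulus of [T]. *)
Lemma invariant_ops_band A : is_band A ->
  is_band [set T : Lr E | forall x, A x -> A (T x)].
Proof.
move=> hA.
have -> : [set T : Lr E | forall x, A x -> A (T x)] =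
    [set T | off_diag A hA T = 0].
  by apply/seteqP; split=> T /= /off_diag_eq0.
apply: ker_band => [a S T|T /Lr_leP T0|T /Lr_leP T0].
- apply: Lr_ext_pos => x _; rewrite LrDE LrZE !off_diagE !LrDE !LrZE.
  by rewrite (band_proj_linear hA) opprD addrACA -scalerBr.
- apply/Lr_leP => x x0; rewrite off_diagE subv_ge0 band_proj_le//.
  by apply: T0; exact: band_proj_ge0.
- apply/Lr_leP => x x0; rewrite off_diagE lev_sublE.
  apply: (@le_trans _ _ (T x)).
    rewrite -subv_ge0 -(linB_op (Lr_linear T)); apply: T0.
    by rewrite subv_ge0 band_proj_le.
  rewrite -{1}[T x]addr0 lev_add2lE; apply: (band_proj_ge0 hA); apply: T0.
  exact: band_proj_ge0.
Qed.

Lemma regular_op_bounded (f : E -> E) : regular_op f -> order_bounded_op f.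
Proof.
move=> [U [W [[lU pU] [lW pW] ->]]] a b.
exists (U a - W b), (U b - W a) => x /andP[ax xb].
by rewrite !fctE; apply/andP; split; apply: lev_add;
  rewrite ?lev_oppE; (try exact: (positive_monotone U)); exact: (positive_monotone W).
Qed.

Lemma Orth_band : is_band (@Orth R E).
Proof.
have -> : Orth = \bigcap_(A in [set A | is_band A])
    [set T : Lr E | forall x, A x -> A (T x)].
  apply/seteqP; split=> [T [_ _ TA]//|T TA]; split=> //.
  - exact: Lr_linear.
  - exact/regular_op_bounded/Lr_regular.
by apply: bigcap_band => A /= hA; exact: invariant_ops_band.
Qed.

Lemma orth_diag_max S T : Orth S -> S <= T -> S <= orth_diag T.
Proof.
move=> oS ST; rewrite -(band_proj_id Orth_band oS).
apply: positive_monotone ST; first exact: (band_proj_linear Orth_band).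
exact: (band_proj_ge0 Orth_band).
Qed.

End Orthomorphisms.

(** * The diagonal of a compression *)

Section BandDiagonal.
Context {R : realType} {E : ocVectorLatticeType R} (B : band_of E).
Implicit Types (S T : Lr E).

(** The point is that a supremum computed in [B] is a supremum in [E]: for an
    upper bound [z] in [E], the element [z /\ s] lies between some [a] in [B]
    and [s] in [B], hence belongs to [B], where it is an upper bound too. *)
Lemma band_val_sup (X : set (band_space B)) s : X !=set0 ->
  supremums X s -> supremums [set val u | u in X] (val s).
Proof.
move=> [u0 Xu0] [ub lb]; split=> [_ [u Xu <-]|z zub]; first exact: ub.
have hB := bandP B.
pose m := vmeet z (val s).
have um u : X u -> val u <= m.
  by move=> Xu; rewrite vmeetP; apply/andP; split;
    [apply: zub; exists u|exact: ub].
have Bm : band_set B m.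
  rewrite -[m](subrK (val u0)); apply: (bandD hB); last exact: band_valP.
  apply: (@band_between _ _ _ hB _ (val s - val u0)).
  - by rewrite subv_ge0 um.
  - by rewrite lev_add2rE vmeet_ler.
  - by apply: (bandD hB); [|apply: (bandN hB)]; exact: band_valP.
apply: (@le_trans _ _ m); last exact: vmeet_lel.
exact: (lb (BandSpace (mem_set Bm))).
Qed.

(** Needed because orthomorphisms of [B] are tested on the bands of the lattice
    [B], and those of [E] on the bands of [E]. *)
Lemma band_trace (A : set E) :
  is_band A -> is_band [set u : band_space B | A (val u)].
Proof.
move=> hA; split; first split.
- exact: band0 hA.
- by move=> a u v; exact: (bandZD hA).
- by move=> u v uv; exact: (band_solid hA uv).
- move=> X s XA sX; have [X0|/set0P Xn0] := eqVneq X set0.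
    by move: sX; rewrite X0 => /supremum_set0 ->; exact: band0 hA.
  apply: (band_sup hA _ (band_val_sup _ _ Xn0 sX)) => _ [u Xu <-].
  exact: XA.
Qed.

(** For [x] in a band [A] of [E], the extension maps [x] to [S (P_B x)], where
    [P_B x] lies in the trace of [A] on [B] since [`|P_B x| <= `|x|]. *)
Lemma extension_orth (S : Lr (band_space B)) : Orth S -> Orth (extension S).
Proof.
move=> [_ _ SA]; split; first exact: Lr_linear.
  exact/regular_op_bounded/Lr_regular.
move=> A hA x Ax; apply: (SA _ (band_trace A hA) (to_band B x)) => /=.
apply: (band_solid hA _ Ax).
have le y : band_proj (band_set B) y <= modulus y.
  have [lP P0] := band_proj_positive _ (bandP B).
  apply: le_trans (band_proj_le _ _ (bandP B) (modulus_ge0 y)).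
  exact: (positive_monotone _ lP P0 _ _ (le_modulus y)).
apply: modulus_le => //; rewrite -modulusN.
apply: le_trans (le _).
by rewrite -[- x]sub0r (linB_op (band_proj_linear (bandP B)))
  (lin0_op (band_proj_linear (bandP B))) sub0r.
Qed.

Lemma band_diag_linear : linear (band_diag B).
Proof.
move=> a S T; have cL : compression B (a *: S + T) =
    a *: compression B S + compression B T.
  by apply: Lr_ext_pos => u _; exact: to_band_linear.
rewrite /band_diag /orth_diag cL (band_proj_linear Orth_band).
exact: Lr_ext_pos.
Qed.

Lemma compression_ge0 T : 0 <= T -> 0 <= compression B T.
Proof. by move=> /Lr_pos pT; apply/Lr_leP/(compression_positive B pT).2. Qed.

Lemma band_diag_ge0 T : 0 <= T -> 0 <= band_diag B T.
Proof.
move=> /compression_ge0 cT; apply/Lr_leP; apply: (extension_positive _).2.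
exact/Lr_pos/(band_proj_ge0 Orth_band).
Qed.

(** [D_B T <= P_B T P_B <= T], the first step because a band projection, here
    the one onto the orthomorphisms of [B], is dominated by the identity. *)
Lemma band_diag_le T : 0 <= T -> band_diag B T <= T.
Proof.
move=> T0; have hB := bandP B; apply/Lr_leP => x x0.
have := band_proj_le _ _ Orth_band (compression_ge0 _ T0).
move=> /Lr_leP/(_ _ (to_band_ge0 B x0)) le.
apply: (le_trans (le : band_diag B T x <= _)) => /=.
move/Lr_pos: T0 => [lT pT].
rewrite (band_proj_id hB (band_proj_mem hB x)).
apply: (le_trans (band_proj_le _ _ hB (pT _ (band_proj_ge0 hB x0)))).
exact: (positive_monotone _ lT pT _ _ (band_proj_le _ _ hB x0)).
Qed.

Lemma band_diag_le_orth_diag T : 0 <= T -> band_diag B T <= orth_diag T.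
Proof.
move=> T0; apply: orth_diag_max; last exact: band_diag_le.
exact/extension_orth/(band_proj_mem Orth_band).
Qed.

End BandDiagonal.
End Bands.

Theorem proposition4p2 (R : realType) (E : ocVectorLatticeType R)
    (B : band_of E) :
  is_band [set T : Lr E | orth_diag T = band_diag B T].
Proof.
have -> : [set T : Lr E | orth_diag T = band_diag B T] =
    [set T | (orth_diag T - band_diag B T = 0)%R].
  apply/seteqP; split=> T /=; first by move=> ->; rewrite GRing.subrr.
  exact: GRing.subr0_eq.
apply: ker_band => [a S T|T T0|T T0].
- rewrite /orth_diag (band_proj_linear Orth_band) band_diag_linear.
  by rewrite GRing.opprD GRing.addrACA -GRing.scalerBr.
- by rewrite subv_ge0; exact: band_diag_le_orth_diag.
- rewrite lev_sublE -{1}[orth_diag T]GRing.addr0; apply: lev_add.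
    exact: (band_proj_le _ _ Orth_band T0).
  exact: band_diag_ge0.
Qed.
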